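(* Let $\mathbf{A}$ be an algebra whose congruence lattice $\operatorname{Con}(\mathbf{A})$ is not modular. Then there is a sublattice of $\operatorname{Con}(\mathbf{A})$ isomorphic to $\mathbf{N}_5$, labelled $\{0_{\mathbf{A}},\gamma,\alpha,\beta,\delta\}$ as a standard pentagon, such that, if $\mathbf{L}$ denotes the sublattice of $\operatorname{Con}(\mathbf{A}(\beta))$ generated by $\{\alpha_0,\alpha_1,\gamma_0,\gamma_1,\beta_0\}$, the following hold: (1) $\mathbf{L}$ is isomorphic to $\mathbf{K}$ if and only if $\alpha_0\wedge\gamma_1$ and $\gamma_0\wedge\alpha_1$ are not comparable; (2) $\mathbf{L}$ is isomorphic to $\mathbf{M}_1$ if and only if $\alpha_0\wedge\gamma_1$ and $\gamma_0\wedge\alpha_1$ are comparable.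
   Context: Algebras are in the sense of universal algebra; $\operatorname{Con}(\mathbf{A})$ is the lattice of congruences of $\mathbf{A}$, and $0_{\mathbf{A}}$ is the identity congruence of $\mathbf{A}$. A standard pentagon in $\operatorname{Con}(\mathbf{A})$ is a five-element sublattice $\{0_{\mathbf{A}},\gamma,\alpha,\beta,\delta\}$ (a copy of $\mathbf{N}_5$) with bottom $0_{\mathbf{A}}$ and top $\delta$, where $0_{\mathbf{A}}<\gamma<\alpha<\delta$, $0_{\mathbf{A}}<\beta<\delta$, $\alpha\wedge\beta=\gamma\wedge\beta=0_{\mathbf{A}}$ and $\alpha\vee\beta=\gamma\vee\beta=\delta$. For $\beta\in\operatorname{Con}(\mathbf{A})$, $\mathbf{A}(\beta)$ is the subalgebra of $\mathbf{A}^2$ with universe $\{(a_0,a_1)\in A^2 : (a_0,a_1)\in\beta\}$. For $\theta\in\operatorname{Con}(\mathbf{A})$ and $i\in\{0,1\}$, $\theta_i$ is the congruence of $\mathbf{A}(\beta)$ given by $\theta_i=\{((a_0,a_1),(b_0,b_1)) : (a_i,b_i)\in\theta\}$. The lattice $\mathbf{M}_1$ is the 11-element lattice with elements $0,e_0,e_1,c_0,c_1,a_0,a_1,b,m,s,d$ and covering relations: $0\prec e_0,e_1,m$; $e_0\prec c_0,b$; $e_1\prec c_1,b$; $m\prec c_0,c_1,s$; $c_0\prec a_0$; $c_1\prec a_1$; $s\prec a_0,a_1$; $a_0,a_1,b\prec d$. The lattice $\mathbf{K}$ is the 14-element lattice with elements $0,e_0,e_1,c_0,c_1,a_0,a_1,b,m,p,q,t,s,d$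 and covering relations: $0\prec e_0,e_1,m$; $e_0\prec c_0,b$; $e_1\prec c_1,b$; $m\prec p,q$; $p\prec c_0,t$; $q\prec c_1,t$; $t\prec s$; $s\prec a_0,a_1$; $c_0\prec a_0$; $c_1\prec a_1$; $a_0,a_1,b\prec d$.
   Formalization: A pentagon with bottom 0_A need not exist (e.g. if A is subdirectly irreducible), so the pentagon here has some bottom ω in Con(A), with ω = 0_A whenever Con(A) contains any standard pentagon; (1) and (2) are unchanged. *)

(* Defs.v *)
From HB Require Import structures.
From mathcomp Require Import all_boot all_order.
From mathcomp Require Import boolp classical_sets functions.
From Stdlib Require Import RelationClasses.

Set Implicit Arguments.
Unset Strict Implicit.
Unset Printing Implicit Defensive.

Import Order.TTheory.

Local Open Scope classical_set_scope.
Local Open Scope order_scope.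

Definition modular_lattice (disp : Order.disp_t) (L : latticeType disp) : Prop :=
  forall x y z : L, x <= z -> x `|` (y `&` z) = (x `|` y) `&` z.

Definition sublattice (disp : Order.disp_t) (L : latticeType disp) (X : set L) :
    Prop :=
  forall x y : L, X x -> X y -> X (x `&` y)%O /\ X (x `|` y)%O.

Definition generated_sublattice (disp : Order.disp_t) (L : latticeType disp)
    (G : set L) : set L :=
  smallest (@sublattice disp L) G.

Definition sublattice_iso (disp disp' : Order.disp_t) (L : latticeType disp)
    (X : set L) (M : latticeType disp') : Prop :=
  sublattice X /\ exists f : {lmorphism M -> L}, set_bij [set: M] X f.

(* Finite lattices given by a function listing the upper covers of each       *)
(* element: the order is the reflexive transitive closure, meets and joins    *)
(* are the greatest lower and least upper bounds.                             *)

Definition covers_le (T : finType) (up : T -> seq T) : rel T :=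
  connect (grel up).

Definition is_glb (T : finType) (le : rel T) (x y z : T) : bool :=
  [&& le z x, le z y & [forall w, le w x && le w y ==> le w z]].

Definition glb (T : finType) (le : rel T) (x y : T) : T :=
  odflt x [pick z | is_glb le x y z].

Definition lub (T : finType) (le : rel T) : T -> T -> T :=
  glb (fun x y => le y x).

Lemma covers_le_dfs (T : finType) (up : T -> seq T) (s : seq T) (x y : T) :
  (forall z, z \in s) -> uniq s ->
  covers_le up x y = (y \in dfs up (size s) [::] x).
Proof.
move=> s_all s_uniq.
have -> : size s = #|T|.
  by rewrite -(card_uniqP s_uniq); apply: eq_card => z; rewrite s_all.
by apply/connectP/dfsP.
Qed.

Lemma is_glbE (T : finType) (le : rel T) (s : seq T) (x y z : T) :
  (forall w, w \in s) ->
  is_glb le x y z =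
    [&& le z x, le z y & all (fun w => le w x && le w y ==> le w z) s].
Proof.
move=> s_all; rewrite /is_glb; congr [&& _, _ & _].
apply/forallP/allP => [h w _|h w]; [exact: h | exact: h].
Qed.

Lemma glbP (T : finType) (le : rel T) (s : seq T) :
    transitive le -> (forall z, z \in s) ->
    all (fun x => all (fun y => has (fun z =>
      [&& le z x, le z y & all (fun w => le w x && le w y ==> le w z) s])
      s) s) s ->
  forall x y z, le x (glb le y z) = le x y && le x z.
Proof.
move=> le_tr s_all s_glb x y z; rewrite /glb.
case: pickP => [g /and3P[gy gz /forallP gP] | no_glb] /=.
  apply/idP/idP => [xg | xyz]; last exact: (implyP (gP x)).
  by rewrite (le_tr _ _ _ xg gy) (le_tr _ _ _ xg gz).
have /allP/(_ y (s_all y))/allP/(_ z (s_all z))/hasP[w _] := s_glb.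
by rewrite -is_glbE // no_glb.
Qed.

Lemma eq_glb_check (T : finType) (le le' : rel T) (s : seq T) : le =2 le' ->
  all (fun x => all (fun y => has (fun z =>
    [&& le z x, le z y & all (fun w => le w x && le w y ==> le w z) s]) s) s) s =
  all (fun x => all (fun y => has (fun z =>
    [&& le' z x, le' z y & all (fun w => le' w x && le' w y ==> le' w z) s])
    s) s) s.
Proof.
move=> ee; apply: eq_all => x; apply: eq_all => y; apply: eq_has => z.
by rewrite !ee; congr [&& _, _ & _]; apply: eq_all => w; rewrite !ee.
Qed.

Lemma covers_le_refl (T : finType) (up : T -> seq T) : reflexive (covers_le up).
Proof. by move=> x; apply: connect0. Qed.

Lemma covers_le_trans (T : finType) (up : T -> seq T) : transitive (covers_le up).
Proof. by move=> x y z; apply: connect_trans. Qed.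

Lemma covers_le_anti (T : finType) (up : T -> seq T) (s : seq T) :
    (forall z, z \in s) -> uniq s ->
    all (fun x => all (fun y =>
      (y \in dfs up (size s) [::] x) && (x \in dfs up (size s) [::] y) ==> (x == y))
      s) s ->
  antisymmetric (covers_le up).
Proof.
move=> s_all s_uniq chk x y; rewrite !(covers_le_dfs up _ _ s_all s_uniq) => xy.
by have /allP/(_ x (s_all x))/allP/(_ y (s_all y))/implyP/(_ xy)/eqP := chk.
Qed.

Lemma covers_glbP (T : finType) (up : T -> seq T) (s : seq T) :
    (forall z, z \in s) -> uniq s ->
    (let le x y := y \in dfs up (size s) [::] x in
     all (fun x => all (fun y => has (fun z =>
      [&& le z x, le z y & all (fun w => le w x && le w y ==> le w z) s])
      s) s) s) ->
  forall x y z, covers_le up x (glb (covers_le up) y z) =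
                covers_le up x y && covers_le up x z.
Proof.
move=> s_all s_uniq chk; apply: (@glbP _ _ s) => //.
  exact: covers_le_trans.
rewrite (eq_glb_check s (fun x y => covers_le_dfs up x y s_all s_uniq)).
exact: chk.
Qed.

Lemma covers_lubP (T : finType) (up : T -> seq T) (s : seq T) :
    (forall z, z \in s) -> uniq s ->
    (let ge x y := x \in dfs up (size s) [::] y in
     all (fun x => all (fun y => has (fun z =>
      [&& ge z x, ge z y & all (fun w => ge w x && ge w y ==> ge w z) s])
      s) s) s) ->
  forall x y z, covers_le up (lub (covers_le up) x y) z =
                covers_le up x z && covers_le up y z.
Proof.
move=> s_all s_uniq chk x y z.
apply: (@glbP _ (fun x y => covers_le up y x) s) => //.
  by move=> b a c ab bc; apply: covers_le_trans bc ab.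
rewrite (eq_glb_check s (fun x y => covers_le_dfs up y x s_all s_uniq)).
exact: chk.
Qed.

Fact N5_display : Order.disp_t. Proof. exact: Order.Disp tt tt. Qed.

Inductive N5 : Set := N5_0 | N5_gamma | N5_alpha | N5_beta | N5_delta.

Definition N5_elts : seq N5 := [:: N5_0; N5_gamma; N5_alpha; N5_beta; N5_delta].

Definition N5_code (x : N5) : nat :=
  match x with
  | N5_0 => 0 | N5_gamma => 1 | N5_alpha => 2 | N5_beta => 3 | N5_delta => 4
  end%N.

Lemma N5_codeK : pcancel N5_code (onth N5_elts). Proof. by case. Qed.

HB.instance Definition _ := Countable.copy N5 (pcan_type N5_codeK).

Lemma N5_enumP : Finite.axiom N5_elts. Proof. by case. Qed.

HB.instance Definition _ := isFinite.Build N5 N5_enumP.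

Definition N5_up (x : N5) : seq N5 :=
  match x with
  | N5_0 => [:: N5_gamma; N5_beta]
  | N5_gamma => [:: N5_alpha]
  | N5_alpha => [:: N5_delta]
  | N5_beta => [:: N5_delta]
  | N5_delta => [::]
  end.

Lemma mem_N5_elts (x : N5) : x \in N5_elts. Proof. by case: x. Qed.

Lemma N5_le_anti : antisymmetric (covers_le N5_up).
Proof. by apply: (covers_le_anti mem_N5_elts) => //; vm_compute. Qed.

HB.instance Definition _ := Order.Le_isPOrder.Build N5_display N5
  (covers_le_refl N5_up) N5_le_anti (@covers_le_trans _ N5_up).

Lemma N5_meetP (x y z : N5) :
  (x <= glb (covers_le N5_up) y z) = (x <= y) && (x <= z).
Proof. by apply: (covers_glbP mem_N5_elts) => //; vm_compute. Qed.

Lemma N5_joinP (x y z : N5) :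
  (lub (covers_le N5_up) x y <= z) = (x <= z) && (y <= z).
Proof. by apply: (covers_lubP mem_N5_elts) => //; vm_compute. Qed.

HB.instance Definition _ :=
  Order.POrder_MeetJoin_isLattice.Build N5_display N5 N5_meetP N5_joinP.

Fact M1_display : Order.disp_t. Proof. exact: Order.Disp tt tt. Qed.

Inductive M1 : Set :=
  | M1_0 | M1_e0 | M1_e1 | M1_c0 | M1_c1 | M1_a0 | M1_a1 | M1_b | M1_m | M1_s
  | M1_d.

Definition M1_elts : seq M1 :=
  [:: M1_0; M1_e0; M1_e1; M1_c0; M1_c1; M1_a0; M1_a1; M1_b; M1_m; M1_s; M1_d].

Definition M1_code (x : M1) : nat :=
  match x with
  | M1_0 => 0 | M1_e0 => 1 | M1_e1 => 2 | M1_c0 => 3 | M1_c1 => 4 | M1_a0 => 5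
  | M1_a1 => 6 | M1_b => 7 | M1_m => 8 | M1_s => 9 | M1_d => 10
  end%N.

Lemma M1_codeK : pcancel M1_code (onth M1_elts). Proof. by case. Qed.

HB.instance Definition _ := Countable.copy M1 (pcan_type M1_codeK).

Lemma M1_enumP : Finite.axiom M1_elts. Proof. by case. Qed.

HB.instance Definition _ := isFinite.Build M1 M1_enumP.

Definition M1_up (x : M1) : seq M1 :=
  match x with
  | M1_0 => [:: M1_e0; M1_e1; M1_m]
  | M1_e0 => [:: M1_c0; M1_b]
  | M1_e1 => [:: M1_c1; M1_b]
  | M1_m => [:: M1_c0; M1_c1; M1_s]
  | M1_c0 => [:: M1_a0]
  | M1_c1 => [:: M1_a1]
  | M1_s => [:: M1_a0; M1_a1]
  | M1_a0 => [:: M1_d]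
  | M1_a1 => [:: M1_d]
  | M1_b => [:: M1_d]
  | M1_d => [::]
  end.

Lemma mem_M1_elts (x : M1) : x \in M1_elts. Proof. by case: x. Qed.

Lemma M1_le_anti : antisymmetric (covers_le M1_up).
Proof. by apply: (covers_le_anti mem_M1_elts) => //; vm_compute. Qed.

HB.instance Definition _ := Order.Le_isPOrder.Build M1_display M1
  (covers_le_refl M1_up) M1_le_anti (@covers_le_trans _ M1_up).

Lemma M1_meetP (x y z : M1) :
  (x <= glb (covers_le M1_up) y z) = (x <= y) && (x <= z).
Proof. by apply: (covers_glbP mem_M1_elts) => //; vm_compute. Qed.

Lemma M1_joinP (x y z : M1) :
  (lub (covers_le M1_up) x y <= z) = (x <= z) && (y <= z).
Proof. by apply: (covers_lubP mem_M1_elts) => //; vm_compute. Qed.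

HB.instance Definition _ :=
  Order.POrder_MeetJoin_isLattice.Build M1_display M1 M1_meetP M1_joinP.

Fact K_display : Order.disp_t. Proof. exact: Order.Disp tt tt. Qed.

Inductive K : Set :=
  | K_0 | K_e0 | K_e1 | K_c0 | K_c1 | K_a0 | K_a1 | K_b | K_m | K_p | K_q | K_t
  | K_s | K_d.

Definition K_elts : seq K :=
  [:: K_0; K_e0; K_e1; K_c0; K_c1; K_a0; K_a1; K_b; K_m; K_p; K_q; K_t; K_s; K_d].

Definition K_code (x : K) : nat :=
  match x with
  | K_0 => 0 | K_e0 => 1 | K_e1 => 2 | K_c0 => 3 | K_c1 => 4 | K_a0 => 5
  | K_a1 => 6 | K_b => 7 | K_m => 8 | K_p => 9 | K_q => 10 | K_t => 11
  | K_s => 12 | K_d => 13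
  end%N.

Lemma K_codeK : pcancel K_code (onth K_elts). Proof. by case. Qed.

HB.instance Definition _ := Countable.copy K (pcan_type K_codeK).

Lemma K_enumP : Finite.axiom K_elts. Proof. by case. Qed.

HB.instance Definition _ := isFinite.Build K K_enumP.

Definition K_up (x : K) : seq K :=
  match x with
  | K_0 => [:: K_e0; K_e1; K_m]
  | K_e0 => [:: K_c0; K_b]
  | K_e1 => [:: K_c1; K_b]
  | K_m => [:: K_p; K_q]
  | K_p => [:: K_c0; K_t]
  | K_q => [:: K_c1; K_t]
  | K_t => [:: K_s]
  | K_s => [:: K_a0; K_a1]
  | K_c0 => [:: K_a0]
  | K_c1 => [:: K_a1]
  | K_a0 => [:: K_d]
  | K_a1 => [:: K_d]
  | K_b => [:: K_d]
  | K_d => [::]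
  end.

Lemma mem_K_elts (x : K) : x \in K_elts. Proof. by case: x. Qed.

Lemma K_le_anti : antisymmetric (covers_le K_up).
Proof. by apply: (covers_le_anti mem_K_elts) => //; vm_compute. Qed.

HB.instance Definition _ := Order.Le_isPOrder.Build K_display K
  (covers_le_refl K_up) K_le_anti (@covers_le_trans _ K_up).

Lemma K_meetP (x y z : K) :
  (x <= glb (covers_le K_up) y z) = (x <= y) && (x <= z).
Proof. by apply: (covers_glbP mem_K_elts) => //; vm_compute. Qed.

Lemma K_joinP (x y z : K) :
  (lub (covers_le K_up) x y <= z) = (x <= z) && (y <= z).
Proof. by apply: (covers_lubP mem_K_elts) => //; vm_compute. Qed.

HB.instance Definition _ :=
  Order.POrder_MeetJoin_isLattice.Build K_display K K_meetP K_joinP.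

Record signature : Type := Signature { op : Type; arity : op -> nat }.

Record algebra (S : signature) : Type := Algebra {
  carrier :> Type;
  interp : forall o : op S, ('I_(arity o) -> carrier) -> carrier
}.

Record Con (S : signature) (A : algebra S) : Type := MkCon {
  con_rel :> A -> A -> Prop;
  con_equiv : Equivalence con_rel;
  con_compat : forall (o : op S) (x y : 'I_(arity o) -> A),
    (forall i, con_rel (x i) (y i)) -> con_rel (interp x) (interp y)
}.

Lemma con_ext (S : signature) (A : algebra S) (th ph : Con A) :
  (forall x y : A, th x y <-> ph x y) -> th = ph.
Proof.
case: th ph => [r re rc] [r' re' rc'] /= rr'.
have e : r = r' by apply/funext => x; apply/funext => y; apply/propext.
by subst r'; congr MkCon; apply: Prop_irrelevance.
Qed.

HB.instance Definition _ (S : signature) (A : algebra S) := gen_eqMixin (Con A).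
HB.instance Definition _ (S : signature) (A : algebra S) :=
  gen_choiceMixin (Con A).

Fact Con_display : Order.disp_t. Proof. exact: Order.Disp tt tt. Qed.

Definition con_le (S : signature) (A : algebra S) (th ph : Con A) : bool :=
  `[< forall x y : A, th x y -> ph x y >].

Lemma con_le_refl (S : signature) (A : algebra S) : reflexive (@con_le S A).
Proof. by move=> th; apply/asboolP. Qed.

Lemma con_le_anti (S : signature) (A : algebra S) : antisymmetric (@con_le S A).
Proof.
move=> th ph /andP[/asboolP h1 /asboolP h2].
by apply: con_ext => x y; split; [apply: h1 | apply: h2].
Qed.

Lemma con_le_trans (S : signature) (A : algebra S) : transitive (@con_le S A).
Proof.
move=> ph th ps /asboolP h1 /asboolP h2.
by apply/asboolP => x y /h1 /h2.
Qed.

HB.instance Definition _ (S : signature) (A : algebra S) :=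
  Order.Le_isPOrder.Build Con_display (Con A)
    (@con_le_refl S A) (@con_le_anti S A) (@con_le_trans S A).

Definition con_inf (S : signature) (A : algebra S) (F : set (Con A)) : Con A.
Proof.
exists (fun x y => forall th, F th -> th x y).
- split.
  + by move=> x th _; apply: (@Equivalence_Reflexive _ _ (con_equiv th)).
  + move=> x y h th Fth.
    exact: (@Equivalence_Symmetric _ _ (con_equiv th)) (h _ Fth).
  + move=> x y z h h' th Fth.
    exact: (@Equivalence_Transitive _ _ (con_equiv th)) (h _ Fth) (h' _ Fth).
- by move=> o x y h th Fth; apply: con_compat => i; apply: h.
Defined.

Definition con_meet (S : signature) (A : algebra S) (th ph : Con A) : Con A :=
  con_inf [set th; ph].

Definition con_join (S : signature) (A : algebra S) (th ph : Con A) : Con A :=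
  con_inf [set ps : Con A | (th <= ps)%O /\ (ph <= ps)%O].

Lemma con_meetP (S : signature) (A : algebra S) (ps th ph : Con A) :
  (ps <= con_meet th ph) = (ps <= th) && (ps <= ph).
Proof.
apply/asboolP/andP => [h | [/asboolP h1 /asboolP h2] x y xy th' /=].
  by split; apply/asboolP => x y /h; apply; [left | right].
by case=> ->; [apply: h1 | apply: h2].
Qed.

Lemma con_joinP (S : signature) (A : algebra S) (th ph ps : Con A) :
  (con_join th ph <= ps) = (th <= ps) && (ph <= ps).
Proof.
apply/asboolP/andP => [h | h x y]; last by apply.
by split; apply/asboolP => x y xy; apply: h => ps' [/asboolP h1 /asboolP h2];
  [apply: h1 | apply: h2].
Qed.

HB.instance Definition _ (S : signature) (A : algebra S) :=
  Order.POrder_MeetJoin_isLattice.Build Con_display (Con A)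
    (@con_meetP S A) (@con_joinP S A).

Definition con_id (S : signature) (A : algebra S) : Con A.
Proof.
exists eq; first exact: eq_equivalence.
by move=> o x y xy; congr interp; apply/funext.
Defined.

Lemma con_id_le (S : signature) (A : algebra S) (th : Con A) : con_id A <= th.
Proof.
by apply/asboolP => x _ <-; apply: (@Equivalence_Reflexive _ _ (con_equiv th)).
Qed.

HB.instance Definition _ (S : signature) (A : algebra S) :=
  Order.hasBottom.Build Con_display (Con A) (@con_id_le S A).

Definition square (S : signature) (A : algebra S) : algebra S :=
  @Algebra S (A * A)%type
    (fun o x => (interp (fun i => (x i).1), interp (fun i => (x i).2))).

Definition subuniverse (S : signature) (B : algebra S) (X : set B) : Prop :=
  forall (o : op S) (x : 'I_(arity o) -> B), (forall i, X (x i)) -> X (interp x).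

Definition subalgebra (S : signature) (B : algebra S) (X : set B)
    (Xop : subuniverse X) : algebra S :=
  @Algebra S {x : B | X x}
    (fun o x => exist X (interp (fun i => sval (x i)))
                        (Xop o _ (fun i => svalP (x i)))).

Definition con_set (S : signature) (A : algebra S) (beta : Con A) :
    set (square A) :=
  fun p => beta p.1 p.2.

Lemma con_set_subuniverse (S : signature) (A : algebra S) (beta : Con A) :
  subuniverse (con_set beta).
Proof. by move=> o x xb; apply: con_compat. Qed.

(* A(beta), a subalgebra of A^2 *)
Definition con_alg (S : signature) (A : algebra S) (beta : Con A) : algebra S :=
  subalgebra (@con_set_subuniverse S A beta).

(* The coordinates 0 and 1 are the booleans false and true. *)
Definition coord (S : signature) (A : algebra S) (beta : Con A) (i : bool)
    (x : con_alg beta) : A :=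
  if i then (sval x).2 else (sval x).1.

Definition con_coord (S : signature) (A : algebra S) (beta : Con A) (i : bool)
    (theta : Con A) : Con (con_alg beta).
Proof.
exists (fun x y => theta (coord i x) (coord i y)).
- case: (con_equiv theta) => r s t; split.
  + by move=> x; apply: r.
  + by move=> x y; apply: s.
  + by move=> x y z; apply: t.
- by case: i => o x y xy; apply: con_compat.
Defined.

Arguments con_coord {S A} beta i theta.

(* The bottom w need not be the least element of L; standard_pentagon is the *)
(* case w = 0_A.                                                              *)
Definition pentagon (disp : Order.disp_t) (L : latticeType disp)
    (w g a b d : L) : Prop :=
  sublattice_iso [set w; g; a; b; d] N5 /\
  [/\ [/\ w < g, g < a & a < d], [/\ w < b & b < d],
      [/\ a `&` b = w & g `&` b = w] & [/\ a `|` b = d & g `|` b = d]].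

Definition standard_pentagon (S : signature) (A : algebra S)
    (gamma alpha beta delta : Con A) : Prop :=
  pentagon (\bot : Con A) gamma alpha beta delta.

Definition pentagon_sublattice (S : signature) (A : algebra S)
    (gamma alpha beta : Con A) : set (Con (con_alg beta)) :=
  generated_sublattice
    [set con_coord beta false alpha; con_coord beta true alpha;
         con_coord beta false gamma; con_coord beta true gamma;
         con_coord beta false beta].

Arguments pentagon_sublattice {S A} gamma alpha beta.

(* Main.v *)
(* Take a pentagon and write p = gamma_0 /\ alpha_1, q = alpha_0 /\ gamma_1,   *)
(* which are exchanged by swapping the coordinates of A(beta). If they are    *)
(* comparable, both are equal to gamma_0 /\ gamma_1, and L is M_1. Otherwise  *)
(* omega_0 \/ q contains the kernel of the first projection, so it is theta_0 *)
(* for some gamma < theta <= alpha; replacing alpha by theta does not change  *)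
(* q, and now omega_0 \/ q = alpha_0, which makes L a quotient of K. It is K  *)
(* itself because p \/ q < alpha_0 /\ alpha_1: the class of (a, a) under p \/ *)
(* q only meets the diagonal within the gamma-class of a.                     *)

Require Import Defs.
From HB Require Import structures.
From mathcomp Require Import all_boot all_order.
From mathcomp Require Import boolp classical_sets functions.
From Stdlib Require Import RelationClasses Relation_Operators.

Set Implicit Arguments.
Unset Strict Implicit.
Unset Printing Implicit Defensive.

Import Order.TTheory.

Local Open Scope classical_set_scope.
Local Open Scope order_scope.

(** Write [x_i] for [con_coord beta i x]. Above the kernel of a projection, the congruences of
    [A(beta)] form a copy of [Con A] ([con_coord_above]); also [beta_0 = beta_1], and sliding pairs
    onto the diagonal gives [th_i <= omega_i \/ (th_0 /\ th_1)] ([con_coord_leUI]). With the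
    pentagon equations this yields every inequality needed for [K] except [alpha_0 <= omega_0 \/ q]
    and its mirror image. If [q <= gamma_0], then [p] and [q] collapse to [gamma_0 /\ gamma_1] and
    [M1] results ([pentagon_M1]); otherwise [pentagon_shrink] lowers [alpha] until the missing
    inequalities hold, and [pentagon_K] applies. Nothing collapses further, by [con_coord_nleU]. The
    converse implications hold because [K] and [M1] differ in size. Isomorphisms with these finite
    lattices are certified by short lists of inequalities ([generated_iso]). *)

Definition saturate (T : eqType) (r : rel T) (s : seq T) (keys : seq (T * T * T))
    (V : seq T) : seq T :=
  let step k V := if (k.1.1 \in V) && (k.1.2 \in V)
                  then [seq z <- s | (z \in V) || r k.2 z] else V in
  (* Every round that enlarges [V] fires some key for the first time, so [size keys] rounds reach
     the closure. *)
  iter (size keys) (fun V => foldr step V keys) V.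

(* For [r] the order of a finite lattice: every meet [x `&` y] is reached from *)
(* [x] and [y] by going up and by the known inequalities [u `&` v <= w], for  *)
(* [(u, v, w)] in [keys]. The converse of the order gives the dual.           *)
Definition bounds_derivable (T : eqType) (r : rel T) (s : seq T)
    (keys : seq (T * T * T)) : bool :=
  all (fun x => all (fun y => has (fun z => r z x && r z y)
    (saturate r s keys [seq z <- s | r x z || r y z])) s) s.

(** In use, [Q z] says that [f z] lies above the meet of [f x] and [f y] (dually, below their join).
    The [z] obtained is then a common bound of [x] and [y], which makes [f] preserve the meet. *)
Lemma bounds_derivableP (T : eqType) (r : rel T) (s : seq T)
    (keys : seq (T * T * T)) (Q : T -> Prop) (x y : T) :
    (forall z, z \in s) ->
    (forall u v, r u v -> Q u -> Q v) ->
    (forall k, k \in keys -> Q k.1.1 -> Q k.1.2 -> Q k.2) ->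
    bounds_derivable r s keys -> Q x -> Q y ->
  exists2 z, r z x && r z y & Q z.
Proof.
move=> s_all Qr Qkeys /allP/(_ x (s_all x))/allP/(_ y (s_all y)) chk Qx Qy.
suff satQ z : z \in saturate r s keys [seq z <- s | r x z || r y z] -> Q z.
  by have /hasP[z /satQ Qz rz] := chk; exists z.
rewrite /saturate; set V0 := [seq _ <- s | _].
have : forall u, u \in V0 -> Q u.
  by move=> u; rewrite mem_filter => /andP[/orP[] /Qr + _]; apply.
elim: (size keys) V0 z => [|n IHn] V z QV /=; first exact: QV.
move: z; rewrite -/(iter n _ V); set W := iter n _ V.
have {IHn} : forall u, u \in W -> Q u by move=> u; apply: IHn.
(* Prepares an induction over a tail of [keys] whose members must still be known to be keys. *)
have : {subset keys <= keys} by [].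
elim: {1 3}keys => [|k ks IHks] //= sub QW z.
have {}IHks := IHks (fun u hu => sub u (mem_behead (s := k :: ks) hu)) QW.
case: ifP => [/andP[/IHks Q1 /IHks Q2] | _]; last exact: IHks.
rewrite mem_filter => /andP[/orP[/IHks // | /Qr + _]]; apply.
by apply: Qkeys => //; apply: sub; rewrite mem_head.
Qed.

(** * Embedding a finite lattice by means of a few inequalities *)

Section FiniteLatticeEmbedding.
Context (disp disp' : Order.disp_t) (T : finLatticeType disp)
  (L : latticeType disp').
Context (up : T -> seq T) (s : seq T) (f : T -> L).
Context (meets joins : seq (T * T * T)) (nonle : seq (T * T)).
Let r : rel T := fun x y => y \in dfs up (size s) [::] x.

Hypothesis le_up : forall x y : T, (x <= y) = covers_le up x y.
Hypothesis s_all : forall x, x \in s.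
Hypothesis s_uniq : uniq s.
Hypothesis f_up : all (fun x => all (fun y => f x <= f y) (up x)) s.
Hypothesis f_meets : all (fun k => f k.1.1 `&` f k.1.2 <= f k.2) meets.
Hypothesis f_joins : all (fun k => f k.2 <= f k.1.1 `|` f k.1.2) joins.
Hypothesis f_nonle : all (fun k => ~~ (f k.1 <= f k.2)) nonle.
Hypothesis meets_check : bounds_derivable r s meets.
Hypothesis joins_check : bounds_derivable (fun x y => r y x) s joins.
Hypothesis nonle_check : all (fun x => all (fun y =>
  r x y || has (fun k => r k.1 x && r y k.2) nonle) s) s.

Let rE (x y : T) : r x y = (x <= y).
Proof. by rewrite le_up (covers_le_dfs up x y s_all s_uniq). Qed.

Let f_homo : {homo f : x y / x <= y}.
Proof.
move=> x y; rewrite le_up => /connectP[p + ->].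
elim: p x => [|z p IHp] x //= /andP[xz /IHp]; apply: le_trans.
exact: (allP (allP f_up x (s_all x))).
Qed.

Let f_meet : {morph f : x y / x `&` y}.
Proof.
move=> x y; apply/le_anti/andP; split.
  by rewrite lexI !f_homo // ?leIl ?leIr.
have [z] : exists2 z, r z x && r z y & f x `&` f y <= f z.
  apply: (bounds_derivableP s_all _ _ meets_check); rewrite ?leIl ?leIr //.
    by move=> u v; rewrite rE => /f_homo fuv /le_trans; apply.
  by move=> k /(allP f_meets) kk u v; apply: le_trans kk; rewrite lexI u v.
by rewrite !rE -lexI => zxy fz; apply: le_trans fz (f_homo zxy).
Qed.

Let f_join : {morph f : x y / x `|` y}.
Proof.
move=> x y; apply/le_anti/andP; split; last first.
  by rewrite leUx !f_homo // ?leUl ?leUr.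
have [z] : exists2 z, r x z && r y z & f z <= f x `|` f y.
  apply: (bounds_derivableP s_all _ _ joins_check); rewrite ?leUl ?leUr //.
    by move=> u v; rewrite rE => /f_homo fuv; apply: le_trans.
  by move=> k /(allP f_joins) kk u v; apply: (le_trans kk); rewrite leUx u v.
by rewrite !rE -leUx => zxy fz; apply: le_trans (f_homo zxy) fz.
Qed.

Let f_inj : injective f.
Proof.
have f_le x y : f x <= f y -> x <= y.
  have /allP/(_ x (s_all x))/allP/(_ y (s_all y)) := nonle_check.
  rewrite rE => /orP[// | /hasP[k /(allP f_nonle)/negP nk]].
  rewrite !rE => /andP[kx yk] fxy; case: nk.
  exact: le_trans (f_homo kx) (le_trans fxy (f_homo yk)).
by move=> x y e; apply/le_anti; rewrite !f_le // e.
Qed.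

Lemma range_iso : sublattice_iso (range f) T.
Proof.
split=> [_ _ [x _ <-] [y _ <-]|].
  by rewrite -f_meet -f_join; split; apply: imageT.
pose F : {lmorphism T -> L} := HB.pack f
  (Order.isOrderMorphism.Build _ _ _ _ f f_homo)
  (Order.isMeetLatticeMorphism.Build _ _ _ _ f f_meet)
  (Order.isJoinLatticeMorphism.Build _ _ _ _ f f_join).
by exists F; split; [move=> x _; apply: imageT | move=> x y _ _ /f_inj | ].
Qed.

Lemma generated_iso (G : set L) :
    G `<=` range f ->
    (forall X, sublattice X -> G `<=` X -> forall x, X (f x)) ->
  sublattice_iso (generated_sublattice G) T.
Proof.
move=> Gf genf; suff -> : generated_sublattice G = range f by exact: range_iso.
apply/seteqP; split; first exact: (smallest_sub range_iso.1).
by move=> _ [x _ <-] X [Xsub GX]; apply: genf.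
Qed.

End FiniteLatticeEmbedding.

(** * Relations on five generators that force [K] or [M1] *)

Section KM1.
Context (disp : Order.disp_t) (L : latticeType disp).
(** To be read as [a_i = alpha_i], [c_i = gamma_i], [e_i = omega_i], [b = beta_0], [d = delta_0]. *)
Context (a0 a1 b c0 c1 d e0 e1 : L).
Let G : set L := [set a0; a1; c0; c1; b].

Hypothesis e0E : a0 `&` b = e0.
Hypothesis e1E : a1 `&` b = e1.
Hypothesis bE : e0 `|` e1 = b.
Hypothesis d0E : c0 `|` e1 = d.
Hypothesis d1E : c1 `|` e0 = d.
Hypothesis le_e0c0 : e0 <= c0.
Hypothesis le_e1c1 : e1 <= c1.
Hypothesis le_c0a0 : c0 <= a0.
Hypothesis le_c1a1 : c1 <= a1.
Hypothesis le_a0d : a0 <= d.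
Hypothesis le_a1d : a1 <= d.
Hypothesis le_c0em : c0 <= e0 `|` (c0 `&` c1).
Hypothesis le_c1em : c1 <= e1 `|` (c0 `&` c1).
Hypothesis nle_ba0 : ~~ (b <= a0).
Hypothesis nle_ba1 : ~~ (b <= a1).
Hypothesis nle_mb : ~~ (c0 `&` c1 <= b).

Let le_e0b : e0 <= b. Proof. by rewrite -e0E leIr. Qed.
Let le_e1b : e1 <= b. Proof. by rewrite -e1E leIr. Qed.
Let le_bd : b <= d.
Proof. by rewrite -bE leUx -{1}d1E -{1}d0E !leUr. Qed.
Let nle_e0a1 : ~~ (e0 <= a1).
Proof. by apply: contra nle_ba1 => h; rewrite -bE leUx h -e1E leIl. Qed.
Let nle_e1a0 : ~~ (e1 <= a0).
Proof. by apply: contra nle_ba0 => h; rewrite -bE leUx h -e0E leIl. Qed.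
Let le_0m : e0 `&` e1 <= c0 `&` c1. Proof. exact: leI2. Qed.

Let gen_sub X : sublattice X -> G `<=` X ->
  [/\ [/\ X a0, X a1, X b, X c0 & X c1], X e0, X e1 & X d].
Proof.
move=> subX GX.
have [Xa0 Xa1 Xb Xc0 Xc1] : [/\ X a0, X a1, X b, X c0 & X c1].
  by split; apply: GX; rewrite /G /=; tauto.
have [Xe0 _] := subX _ _ Xa0 Xb; have [Xe1 _] := subX _ _ Xa1 Xb.
by rewrite e0E in Xe0; rewrite e1E in Xe1; rewrite -d0E; have [_] := subX _ _ Xc0 Xe1.
Qed.

(** With [p], [q], [s], [t] as in [K], the first two inequalities give [a0 = e0 \/ q] and
    [a1 = e1 \/ p]; the three negated ones keep [m], [p], [q], [t], [s] apart. *)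
Lemma generated_K :
    a0 <= e0 `|` (a0 `&` c1) -> a1 <= e1 `|` (c0 `&` a1) ->
    ~~ (c0 `&` a1 <= c1) -> ~~ (a0 `&` c1 <= c0) ->
    ~~ (a0 `&` a1 <= (c0 `&` a1) `|` (a0 `&` c1)) ->
  sublattice_iso (generated_sublattice G) K.
Proof.
move=> le_a0 le_a1 nle_pc1 nle_qc0 nle_st.
pose f (x : K) := match x with
  | K_0 => e0 `&` e1 | K_e0 => e0 | K_e1 => e1 | K_c0 => c0 | K_c1 => c1
  | K_a0 => a0 | K_a1 => a1 | K_b => b | K_m => c0 `&` c1
  | K_p => c0 `&` a1 | K_q => a0 `&` c1
  | K_t => (c0 `&` a1) `|` (a0 `&` c1) | K_s => a0 `&` a1 | K_d => d
  end.
apply: (@generated_iso _ _ K L K_up K_elts f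
  [:: (K_a0, K_a1, K_s); (K_a0, K_b, K_e0); (K_a1, K_b, K_e1);
      (K_c0, K_a1, K_p); (K_a0, K_c1, K_q); (K_e0, K_e1, K_0);
      (K_c0, K_c1, K_m)]
  [:: (K_e0, K_e1, K_b); (K_e0, K_m, K_c0); (K_e1, K_m, K_c1);
      (K_e0, K_q, K_a0); (K_e1, K_p, K_a1); (K_p, K_q, K_t);
      (K_c0, K_e1, K_d); (K_c1, K_e0, K_d)]
  [:: (K_e0, K_a1); (K_e1, K_a0); (K_m, K_b); (K_p, K_c1); (K_q, K_c0);
      (K_s, K_t)] (fun _ _ => erefl) mem_K_elts).
- by [].
- by rewrite /= leIl leIr le_0m le_e0c0 le_e1c1 le_e0b le_e1b le_c0a0 le_c1a1
    le_a0d le_a1d le_bd !leI2 // leIl leIr leUl leUr leUx !leI2 // leIl leIr.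
- by rewrite /= e0E e1E !lexx.
- by rewrite /= bE d0E d1E !lexx le_c0em le_c1em le_a0 le_a1.
- by rewrite /= nle_e0a1 nle_e1a0 nle_mb nle_pc1 nle_qc0 nle_st.
- by vm_compute.
- by vm_compute.
- by vm_compute.
- move=> x [[[[->|->]|->]|->]|->].
  + by exists K_a0.
  + by exists K_a1.
  + by exists K_c0.
  + by exists K_c1.
  + by exists K_b.
- move=> X subX /(gen_sub subX)[[Xa0 Xa1 Xb Xc0 Xc1] Xe0 Xe1 Xd].
  have XI x y : X x -> X y -> X (x `&` y) by move=> Xx /(subX _ _ Xx)[].
  have XU x y : X x -> X y -> X (x `|` y) by move=> Xx /(subX _ _ Xx)[].
  by case=> /=; auto.
Qed.

(** Here [p] and [q], hence also their join, collapse to [m], and [s] takes over their role in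
    producing [a0] and [a1]. *)
Lemma generated_M1 :
    a0 <= e0 `|` (a0 `&` a1) -> a1 <= e1 `|` (a0 `&` a1) ->
    c0 `&` a1 <= c1 -> a0 `&` c1 <= c0 -> ~~ (a0 `&` a1 <= c0 `&` c1) ->
  sublattice_iso (generated_sublattice G) M1.
Proof.
move=> le_a0 le_a1 le_pc1 le_qc0 nle_sm.
pose f (x : M1) := match x with
  | M1_0 => e0 `&` e1 | M1_e0 => e0 | M1_e1 => e1 | M1_c0 => c0 | M1_c1 => c1
  | M1_a0 => a0 | M1_a1 => a1 | M1_b => b | M1_m => c0 `&` c1
  | M1_s => a0 `&` a1 | M1_d => d
  end.
have le_pm : c0 `&` a1 <= c0 `&` c1 by rewrite lexI leIl.
have le_qm : a0 `&` c1 <= c0 `&` c1 by rewrite lexI leIr le_qc0.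
apply: (@generated_iso _ _ M1 L M1_up M1_elts f
  [:: (M1_a0, M1_a1, M1_s); (M1_a0, M1_b, M1_e0); (M1_a1, M1_b, M1_e1);
      (M1_c0, M1_a1, M1_m); (M1_a0, M1_c1, M1_m); (M1_e0, M1_e1, M1_0)]
  [:: (M1_e0, M1_e1, M1_b); (M1_e0, M1_m, M1_c0); (M1_e1, M1_m, M1_c1);
      (M1_e0, M1_s, M1_a0); (M1_e1, M1_s, M1_a1);
      (M1_c0, M1_e1, M1_d); (M1_c1, M1_e0, M1_d)]
  [:: (M1_e0, M1_a1); (M1_e1, M1_a0); (M1_m, M1_b); (M1_s, M1_c0);
      (M1_s, M1_c1)] (fun _ _ => erefl) mem_M1_elts).
- by [].
- by rewrite /= leIl leIr le_0m le_e0c0 le_e1c1 le_e0b le_e1b le_c0a0 le_c1a1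
    le_a0d le_a1d le_bd !leI2 // !leIl !leIr.
- by rewrite /= e0E e1E !lexx le_pm le_qm.
- by rewrite /= bE d0E d1E !lexx le_c0em le_c1em le_a0 le_a1.
(* If [s <= c0], then [s <= c0 /\ a1 <= m]; symmetrically for [c1]. *)
- rewrite /= nle_e0a1 nle_e1a0 nle_mb /= andbT; apply/andP; split.
    apply: contra nle_sm => h; apply: le_trans le_pm.
    by rewrite lexI h leIr.
  apply: contra nle_sm => h; apply: le_trans le_qm.
  by rewrite lexI h leIl.
- by vm_compute.
- by vm_compute.
- by vm_compute.
- move=> x [[[[->|->]|->]|->]|->].
  + by exists M1_a0.
  + by exists M1_a1.
  + by exists M1_c0.
  + by exists M1_c1.
  + by exists M1_b.
- move=> X subX /(gen_sub subX)[[Xa0 Xa1 Xb Xc0 Xc1] Xe0 Xe1 Xd].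
  have XI x y : X x -> X y -> X (x `&` y) by move=> Xx /(subX _ _ Xx)[].
  have XU x y : X x -> X y -> X (x `|` y) by move=> Xx /(subX _ _ Xx)[].
  by case=> /=; auto.
Qed.

End KM1.

(** * Pentagons in a lattice, and the sizes of [K] and [M1] *)

(** Any further comparability forces [g = a]: from [g <= b] follows [a <= d = b], so both equal [w];
    dually, [b <= a] makes both equal [d]. *)
Lemma pentagonP (disp : Order.disp_t) (L : latticeType disp) (w g a b d : L) :
    g < a -> a `&` b = w -> g `&` b = w -> a `|` b = d -> g `|` b = d ->
  pentagon w g a b d.
Proof.
move=> ga abw gbw abd gbd.
have [le_wg le_wb le_ad le_bd] : [/\ w <= g, w <= b, a <= d & b <= d].
  by rewrite -{1}gbw -abw -{1}abd -abd leIl leIr leUl leUr.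
have nle_gb : ~~ (g <= b).
  apply/negP => gb; have ab : a <= b by rewrite -(join_r gb) gbd.
  by move: gbw abw ga; rewrite (meet_l gb) (meet_l ab) => -> ->; rewrite ltxx.
have nle_ba : ~~ (b <= a).
  apply/negP => ba; have bg : b <= g by rewrite -(meet_r ba) abw.
  by move: gbd abd ga; rewrite (join_l bg) (join_l ba) => -> ->; rewrite ltxx.
pose f (x : N5) := match x with
  | N5_0 => w | N5_gamma => g | N5_alpha => a | N5_beta => b | N5_delta => d
  end.
split; last first.
  split=> //.
  - rewrite ga !lt_neqAle le_wg le_ad !andbT; split=> //.
    + by apply: contra nle_gb => /eqP <-.
    + by apply: contra nle_ba => /eqP ->.
  - rewrite !lt_neqAle le_wb le_bd !andbT; split.
    + by apply: contra nle_ba => /eqP <-; apply: le_trans le_wg (ltW ga).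
    + by apply: contra nle_gb => /eqP ->; apply: le_trans (ltW ga) le_ad.
have -> : [set w; g; a; b; d] = range f.
  apply/seteqP; split=> [x [[[[->|->]|->]|->]|->] | _ [x _ <-]].
  - by exists N5_0.
  - by exists N5_gamma.
  - by exists N5_alpha.
  - by exists N5_beta.
  - by exists N5_delta.
  - case: x; [do 4!left | do 3!left; right | do 2!left; right | left; right
             | right] => //.
apply: (@range_iso _ _ N5 L N5_up N5_elts f [:: (N5_alpha, N5_beta, N5_0)]
  [:: (N5_gamma, N5_beta, N5_delta)]
  [:: (N5_alpha, N5_gamma); (N5_gamma, N5_beta); (N5_beta, N5_alpha)]
  (fun _ _ => erefl) mem_N5_elts).
- by [].
- by rewrite /= le_wg le_wb le_ad le_bd ltW.
- by rewrite /= abw lexx.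
- by rewrite /= gbd lexx.
- by rewrite /= nle_gb nle_ba (lt_geF ga).
- by vm_compute.
- by vm_compute.
- by vm_compute.
Qed.

(** Dedekind's construction: the two unequal sides of a failing modular law are [g < a], and [y] is
    [b]. *)
Lemma nonmodular_pentagon (disp : Order.disp_t) (L : latticeType disp) :
  ~ modular_lattice L -> exists w g a b d : L, pentagon w g a b d.
Proof.
move=> /existsNP[x /existsNP[y /existsNP[z /not_implyP[xz /eqP ne]]]].
have le_ga : x `|` (y `&` z) <= (x `|` y) `&` z.
  by rewrite lexI !leUx xz leUl leIr (le_trans (leIl _ _) (leUr _ _)).
have abw : ((x `|` y) `&` z) `&` y = y `&` z.
  by rewrite meetAC (meet_r (leUr _ _)).
have gbd : (x `|` (y `&` z)) `|` y = x `|` y.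
  by rewrite -joinA (join_r (leIl _ _)).
exists (y `&` z), (x `|` (y `&` z)), ((x `|` y) `&` z), y, (x `|` y).
apply: pentagonP => //; first by rewrite lt_neqAle ne le_ga.
- apply/le_anti/andP; split; first by rewrite -{2}abw leI2.
  by rewrite lexI leUr leIl.
- apply/le_anti/andP; split; first by rewrite leUx leIl leUr.
  by rewrite -{1}gbd leU2.
Qed.

Lemma sublattice_iso_card (disp disp1 disp2 : Order.disp_t)
    (L : latticeType disp) (M : finLatticeType disp1)
    (N : finLatticeType disp2) (X : set L) :
  sublattice_iso X M -> sublattice_iso X N -> (#|M| <= #|N|)%N.
Proof.
move=> [_ [f [fX f_inj _]]] [_ [g [_ _ gX]]].
have /choice[h hP] : forall x, exists y, g y = f x.
  by move=> x; have [y _ <-] := gX _ (fX x I); exists y.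
apply: (leq_card h) => x y hxy.
by apply: f_inj; rewrite ?in_setT // -!hP hxy.
Qed.

Lemma card_seq (T : finType) (s : seq T) :
  (forall x, x \in s) -> uniq s -> #|T| = size s.
Proof.
by move=> s_all /card_uniqP <-; apply: eq_card => x; rewrite s_all.
Qed.

Lemma K_M1_not_iso (disp : Order.disp_t) (L : latticeType disp) (X : set L) :
  sublattice_iso X M1 -> sublattice_iso X K -> False.
Proof.
move=> XM XK; have := sublattice_iso_card XK XM.
by rewrite (card_seq mem_K_elts) // (card_seq mem_M1_elts).
Qed.

(** * Joins of congruences as chains *)

Section Congruences.
Context (S : signature) (A : algebra S).
Implicit Types (th ph ps : Con A) (x y z : A).

Lemma con_refl th x : th x x.
Proof. exact: (@Equivalence_Reflexive _ _ (con_equiv th)). Qed.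

Lemma con_sym th x y : th x y -> th y x.
Proof. exact: (@Equivalence_Symmetric _ _ (con_equiv th)). Qed.

Lemma con_trans th y x z : th x y -> th y z -> th x z.
Proof. exact: (@Equivalence_Transitive _ _ (con_equiv th)). Qed.

Lemma con_leP th ph : reflect (forall x y, th x y -> ph x y) (th <= ph).
Proof. exact: asboolP. Qed.

Lemma con_meetE th ph x y : (th `&` ph) x y <-> th x y /\ ph x y.
Proof.
change (con_meet th ph x y <-> th x y /\ ph x y).
split=> [xy | [thxy phxy] ps [->|->] //].
by split; apply: xy; [left | right].
Qed.

Let step th ph x y := th x y \/ ph x y.

(** The join is defined as an infimum of upper bounds; chains of steps give an upper bound that can
    be handled by induction. *)
Let chain_con th ph : Con A.
Proof.
exists (clos_refl_trans A (step th ph)).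
- split=> [x | x y | x y z]; [exact: rt_refl | | exact: rt_trans].
  elim=> [u v [] /con_sym uv | u | u v w _ vu _ wv].
  + by apply: rt_step; left.
  + by apply: rt_step; right.
  + exact: rt_refl.
  + exact: rt_trans wv vu.
- move=> o x y xy.
  (* Change the arguments one at a time, each along its own chain. *)
  pose z k (i : 'I_(arity o)) := if (i < k)%N then y i else x i.
  have zP k : (k <= arity o)%N ->
      clos_refl_trans A (step th ph) (interp x) (interp (z k)).
    elim: k => [_ | k IHk k_lt]; first exact: rt_refl.
    apply: rt_trans (IHk (ltnW k_lt)) _.
    pose i0 := Ordinal k_lt.
    pose u a (i : 'I_(arity o)) := if i == i0 then a else z k i.
    have -> : z k = u (x i0).
      apply/funext => i; rewrite /u; case: eqP => // ->.
      by rewrite /z /= ltnn.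
    have -> : z k.+1 = u (y i0).
      apply/funext => i; rewrite /u /z ltnS leq_eqVlt -(inj_eq val_inj) /=.
      by case: eqP => //= ik; congr y; apply: val_inj.
    elim: (xy i0) => [a b ab | a | a b c _ ab _ bc].
    + by apply: rt_step; case: ab => ab; [left | right];
        apply: con_compat => i; rewrite /u; case: eqP => // _;
        apply: con_refl.
    + exact: rt_refl.
    + exact: rt_trans ab bc.
  have := zP _ (leqnn _); congr (clos_refl_trans _ _ _ (interp _)).
  by apply/funext => i; rewrite /z ltn_ord.
Defined.

Lemma con_join_invariant th ph (P : A -> Prop) x y :
    (forall u v, th u v -> P u -> P v) -> (forall u v, ph u v -> P u -> P v) ->
  (th `|` ph) x y -> P x -> P y.
Proof.
move=> thP phP xy; suff : clos_refl_trans A (step th ph) x y.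
  by elim=> [u v [/thP | /phP] | u | u v w _ Puv _ Pvw /Puv/Pvw].
apply: (con_leP (th `|` ph) (chain_con th ph) _) x y xy.
by rewrite leUx; apply/andP; split; apply/con_leP => u v uv; apply: rt_step;
  [left | right].
Qed.

End Congruences.

(** * Congruences of [A(beta)] *)

Section ConAlg.
Context (S : signature) (A : algebra S) (beta : Con A).
Implicit Types (th ph w : Con A) (ps : Con (con_alg beta)) (i : bool).
Implicit Types (x y z : con_alg beta).
Local Notation cc := (con_coord beta).

Definition beta_pair (a0 a1 : A) (h : beta a0 a1) : con_alg beta :=
  exist (con_set beta) (a0, a1) h.

Definition diag (a : A) : con_alg beta := beta_pair (con_refl beta a).

Lemma coord_diag i (a : A) : coord i (diag a) = a.
Proof. by case: i. Qed.

Lemma coord_related i j x : beta (coord i x) (coord j x).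
Proof.
case: x => [[x0 x1] h]; case: i; case: j => /=; try exact: con_refl.
  exact: con_sym.
exact: h.
Qed.

Lemma con_coord_le i th ph : (cc i th <= cc i ph) = (th <= ph).
Proof.
apply/con_leP/con_leP => h x y; last exact: h.
by have := h (diag x) (diag y); rewrite /= !coord_diag.
Qed.

Lemma con_coordI i th ph : cc i (th `&` ph) = cc i th `&` cc i ph.
Proof. by apply: con_ext => x y; rewrite con_meetE; apply: con_meetE. Qed.

(* The interval above the kernel of a projection is a copy of [Con A]. *)
Lemma con_coord_above i ps : cc i \bot <= ps -> exists th, ps = cc i th.
Proof.
move=> /con_leP ker.
have ps_diag x : ps x (diag (coord i x)) by apply: ker; rewrite /= coord_diag.
have th_equiv : Equivalence (fun a b => ps (diag a) (diag b)).
  split=> [a | a b | a b c]; [exact: con_refl | exact: con_sym |].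
  exact: con_trans.
have th_compat (o : op S) (a b : 'I_(arity o) -> A) :
    (forall j, ps (diag (a j)) (diag (b j))) ->
    ps (diag (interp a)) (diag (interp b)).
  move=> /(con_compat (c := ps)) ab.
  have diag_interp (c : 'I_(arity o) -> A) :
      interp (fun j => diag (c j)) = diag (interp c) :> con_alg beta.
    exact: eq_exist.
  by rewrite -!diag_interp.
exists (MkCon th_equiv th_compat); apply: con_ext => x y /=; split=> xy.
  exact: con_trans (con_sym (ps_diag x)) (con_trans xy (ps_diag y)).
exact: con_trans (ps_diag x) (con_trans xy (con_sym (ps_diag y))).
Qed.

(** As [ps] contains the kernel it is [ch_i] for some [ch], so the comparison takes place in
    [Con A]. *)
Lemma con_coord_leU i th ph ps :
  cc i \bot <= ps -> cc i th <= ps -> cc i ph <= ps -> cc i (th `|` ph) <= ps.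
Proof.
move=> /con_coord_above[ch ->]; rewrite !con_coord_le => thch phch.
by rewrite leUx thch.
Qed.

Lemma con_coord_eq i j th : beta <= th -> cc i th = cc j th.
Proof.
move=> /con_leP le_beta; apply: con_ext => x y /=.
have rel k l z : th (coord k z) (coord l z).
  by apply: le_beta; apply: coord_related.
split=> xy; exact: con_trans (con_trans (rel _ _ x) xy) (rel _ _ y).
Qed.

(** If [x] and [y] are related by [beta_0 = beta_1], then [(x_0, y_1)] lies in [A(beta)] and shares
    one coordinate with each. *)
Lemma con_coord_beta w : w <= beta -> cc false w `|` cc true w = cc false beta.
Proof.
move=> le_w; apply/le_anti; rewrite leUx con_coord_le le_w.
rewrite (con_coord_eq false true (lexx beta)) con_coord_le le_w /=.
apply/con_leP => x y xy.
have h : beta (coord false x) (coord true y).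
  exact: con_trans (coord_related _ _ _) xy.
apply: (con_trans (y := beta_pair h)).
  by apply: (con_leP _ _ (leUl _ _)) => /=; apply: con_refl.
by apply: (con_leP _ _ (leUr _ _)) => /=; apply: con_refl.
Qed.

(** Both pairs slide, with coordinate [i] fixed, to diagonal pairs, which are [th]-related in both
    coordinates. *)
Lemma con_coord_leUI i w th :
  cc i th <= cc i w `|` (cc false th `&` cc true th).
Proof.
apply/con_leP => x y xy.
have ker z : (cc i w `|` (cc false th `&` cc true th)) z (diag (coord i z)).
  apply: (con_leP _ _ (leUl _ _)); rewrite /= coord_diag; exact: con_refl.
apply: con_trans (ker x) (con_trans _ (con_sym (ker y))).
by apply: (con_leP _ _ (leUr _ _)); rewrite con_meetE.
Qed.

Definition swap x : con_alg beta := beta_pair (con_sym (svalP x)).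

Lemma swapK : involutive swap.
Proof. by case=> [[x0 x1] h]; apply: eq_exist. Qed.

Lemma coord_swap i x : coord i (swap x) = coord (~~ i) x.
Proof. by case: i. Qed.

(** A lattice automorphism exchanging the indices 0 and 1, hence [p] and [q]; it gives mirror images
    of inequalities for free. *)
Definition con_swap ps : Con (con_alg beta).
Proof.
exists (fun x y => ps (swap x) (swap y)).
- split=> [x | x y | x y z]; [exact: con_refl | exact: con_sym |].
  exact: con_trans.
- move=> o x y /(con_compat (c := ps)).
  have swap_interp (z : 'I_(arity o) -> con_alg beta) :
    interp (fun j => swap (z j)) = swap (interp z) by exact: eq_exist.
  by rewrite !swap_interp.
Defined.

Lemma con_swapK : involutive con_swap.
Proof. by move=> ps; apply: con_ext => x y /=; rewrite !swapK. Qed.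

Lemma con_swap_le ps ps' : (con_swap ps <= con_swap ps') = (ps <= ps').
Proof.
apply/con_leP/con_leP => h x y xy; last exact: h.
by have := h (swap x) (swap y); rewrite /= !swapK; apply.
Qed.

Lemma con_swapI : {morph con_swap : ps ps' / ps `&` ps'}.
Proof.
by move=> ps ps'; apply: con_ext => x y; rewrite con_meetE; apply: con_meetE.
Qed.

Lemma con_swapU : {morph con_swap : ps ps' / ps `|` ps'}.
Proof.
move=> ps ps'; apply/le_anti/andP; split; last first.
  by rewrite leUx !con_swap_le leUl leUr.
rewrite -con_swap_le con_swapK leUx.
by rewrite -con_swap_le con_swapK leUl -con_swap_le con_swapK leUr.
Qed.

Lemma con_swap_coord i th : con_swap (cc i th) = cc (~~ i) th.
Proof. by apply: con_ext => x y /=; rewrite !coord_swap. Qed.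

(* A chain of steps of the two joinands starting at a diagonal pair stays     *)
(* among the pairs related by [alpha `&` beta], hence its [gamma]-class is    *)
(* constant.                                                                  *)
Lemma con_coord_nleU alpha gamma :
    alpha `&` beta <= gamma -> gamma < alpha ->
  ~~ (cc false alpha `&` cc true alpha <=
      (cc false gamma `&` cc true alpha) `|` (cc false alpha `&` cc true gamma)).
Proof.
move=> /con_leP le_abg lt_ga; have /con_leP le_ga := ltW lt_ga.
apply/negP => /con_leP le_st.
suff : alpha <= gamma by rewrite (lt_geF lt_ga).
apply/con_leP => a b ab.
have close z : alpha (coord false z) (coord true z) ->
    gamma (coord false z) (coord true z).
  move=> az; apply: le_abg; rewrite con_meetE; split=> //.
  exact: coord_related.
pose P z := gamma a (coord false z) /\ alpha (coord false z) (coord true z).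
suff [] : P (diag b) by [].
apply: (con_join_invariant _ _ (le_st (diag a) (diag b) _)).
- move=> u v /con_meetE[/= uv0 uv1] [au uu]; split; first exact: con_trans uv0.
  exact: con_trans (con_sym (le_ga _ _ uv0)) (con_trans uu uv1).
(* A [q]-step controls only second coordinates modulo [gamma], so the route is [u_0], [u_1], [v_1],
   [v_0], with [close] at both ends. *)
- move=> u v /con_meetE[/= uv0 uv1] [au uu].
  have vv : alpha (coord false v) (coord true v).
    exact: con_trans (con_sym uv0) (con_trans uu (le_ga _ _ uv1)).
  split=> //; apply: con_trans au (con_trans (close _ uu) _).
  exact: con_trans uv1 (con_sym (close _ vv)).
- by rewrite con_meetE.
- by split; apply: con_refl.
Qed.

End ConAlg.

(** * The lattice generated from a pentagon *)

Section Pentagon.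
Context (S : signature) (A : algebra S) (omega gamma alpha beta delta : Con A).
Hypothesis pentagonH : pentagon omega gamma alpha beta delta.

Local Notation cc := (con_coord beta).
Local Notation p := (cc false gamma `&` cc true alpha).
Local Notation q := (cc false alpha `&` cc true gamma).
Local Notation m := (cc false gamma `&` cc true gamma).

Let lt_ga : gamma < alpha. Proof. by case: pentagonH => _ [[]]. Qed.
Let lt_wg : omega < gamma. Proof. by case: pentagonH => _ [[]]. Qed.
Let lt_wb : omega < beta. Proof. by case: pentagonH => _ [_ []]. Qed.
Let abw : alpha `&` beta = omega. Proof. by case: pentagonH => _ [_ _ []]. Qed.
Let gbd : gamma `|` beta = delta. Proof. by case: pentagonH => _ [_ _ _ []]. Qed.
Let lt_ad : alpha < delta. Proof. by case: pentagonH => _ [[]]. Qed.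
Let lt_bd : beta < delta. Proof. by case: pentagonH => _ [_ []]. Qed.
Let gbw : gamma `&` beta = omega. Proof. by case: pentagonH => _ [_ _ []]. Qed.

Let swap_p : con_swap p = q.
Proof. by rewrite con_swapI !con_swap_coord meetC. Qed.

(** Always [q <= gamma_1 <= alpha_1], so only [gamma_0] matters for [q <= p]; the swap turns
    [p <= q] into [q <= p]. *)
Lemma pentagon_comparable : (q >=< p) = (q <= cc false gamma).
Proof.
have le_qp : (q <= p) = (q <= cc false gamma).
  rewrite lexI; case: (_ <= cc false gamma) => //=.
  by apply: le_trans (leIr _ _) _; rewrite con_coord_le ltW.
apply/orP/idP => [[]|]; rewrite -?le_qp //; last by left.
by rewrite -con_swap_le swap_p -swap_p con_swapK.
Qed.

Let alphaI i : cc i alpha `&` cc false beta = cc i omega.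
Proof. by rewrite (con_coord_eq false i (lexx beta)) -con_coordI abw. Qed.

Let omegaU : cc false omega `|` cc true omega = cc false beta.
Proof. by rewrite con_coord_beta ?ltW. Qed.

(** The join contains the kernel of projection [i], [gamma_i], and [beta_i = omega_0 \/ omega_1],
    hence [(gamma \/ beta)_i]. *)
Let gammaU i : cc i gamma `|` cc (~~ i) omega = cc false delta.
Proof.
have eq_d := con_coord_eq _ _ (ltW lt_bd).
have lt_gd := lt_trans lt_ga lt_ad.
apply/le_anti/andP; split.
  rewrite leUx (eq_d false i) con_coord_le (ltW lt_gd) (eq_d i (~~ i)).
  by rewrite con_coord_le (ltW (lt_trans lt_wg lt_gd)).
rewrite (eq_d false i) -gbd; apply: con_coord_leU; last 2 first.
- exact: leUl.
- rewrite (con_coord_eq i false (lexx beta)) -omegaU leUx.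
  by case: (i); rewrite /= leUr andbC /= ?andbT;
    apply: le_trans (leUl _ _); rewrite con_coord_le ltW.
- by apply: le_trans (leUl _ _); rewrite con_coord_le le0x.
Qed.

Let nle_ba i : ~~ (cc false beta <= cc i alpha).
Proof.
rewrite (con_coord_eq false i (lexx beta)) con_coord_le.
by apply/negP => /meet_r; rewrite abw => e; move: lt_wb; rewrite e ltxx.
Qed.

Let nle_mb : ~~ (m <= cc false beta).
Proof.
apply/negP => mb; have : gamma <= beta.
  rewrite -(con_coord_le beta false).
  apply: le_trans (con_coord_leUI beta false omega gamma) _.
  by rewrite leUx mb con_coord_le ltW.
by move=> /meet_l; rewrite gbw => e; move: lt_wg; rewrite e ltxx.
Qed.

Let alpha_d i : cc i alpha <= cc false delta.
Proof.
by rewrite (con_coord_eq false i (ltW lt_bd)) con_coord_le ltW.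
Qed.

Let omega_gamma i : cc i omega <= cc i gamma.
Proof. by rewrite con_coord_le ltW. Qed.

Let gamma_alpha i : cc i gamma <= cc i alpha.
Proof. by rewrite con_coord_le ltW. Qed.

Let leUI i th := con_coord_leUI beta i omega th.

Lemma pentagon_M1 :
  q <= cc false gamma -> sublattice_iso (pentagon_sublattice gamma alpha beta) M1.
Proof.
move=> le_qc0.
apply: (generated_M1 (alphaI false) (alphaI true) omegaU (gammaU false)
  (gammaU true) (omega_gamma false) (omega_gamma true) (gamma_alpha false)
  (gamma_alpha true) (alpha_d false) (alpha_d true) (leUI false gamma)
  (leUI true gamma) (nle_ba false) (nle_ba true) nle_mb
  (leUI false alpha) (leUI true alpha) _ le_qc0).
  by rewrite -con_swap_le swap_p con_swap_coord.
have le_abg : alpha `&` beta <= gamma by rewrite abw ltW.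
(* Since [m <= p], the meet of [alpha_0] and [alpha_1] cannot lie below [m]. *)
apply: contra (con_coord_nleU le_abg lt_ga) => /le_trans; apply.
by apply: le_trans (leUl _ _); rewrite leI2.
Qed.

Lemma pentagon_K :
    ~~ (q <= cc false gamma) -> cc false alpha <= cc false omega `|` q ->
  sublattice_iso (pentagon_sublattice gamma alpha beta) K.
Proof.
move=> nle_qc0 le_a0.
apply: (generated_K (alphaI false) (alphaI true) omegaU (gammaU false)
  (gammaU true) (omega_gamma false) (omega_gamma true) (gamma_alpha false)
  (gamma_alpha true) (alpha_d false) (alpha_d true) (leUI false gamma)
  (leUI true gamma) (nle_ba false) (nle_ba true) nle_mb
  le_a0 _ _ nle_qc0).
- by rewrite -con_swap_le con_swapU swap_p !con_swap_coord.
- by rewrite -con_swap_le swap_p con_swap_coord.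
- by apply: con_coord_nleU lt_ga; rewrite abw ltW.
Qed.

(** The congruence [omega_0 \/ q] contains a kernel, so it is some [theta_0]. It lies above
    [gamma_0] because [m <= q], strictly because [q] is not below [gamma_0]. As [q] is unchanged,
    the new pentagon satisfies the hypotheses of [pentagon_K]. *)
Lemma pentagon_shrink : ~~ (q <= cc false gamma) -> exists theta,
  [/\ pentagon omega gamma theta beta delta,
      cc false theta `&` cc true gamma = q
    & cc false theta = cc false omega `|` q].
Proof.
move=> nle_qc0.
have [|theta thetaE] := @con_coord_above _ _ _ false (cc false omega `|` q).
  by apply: le_trans (leUl _ _); rewrite con_coord_le le0x.
have le_qt : q <= cc false theta by rewrite -thetaE leUr.
have le_gt : gamma <= theta.
  rewrite -(con_coord_le beta false) -thetaE; apply: le_trans (leUI _ _) _.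
  by rewrite leU2 // leI2.
have le_ta : theta <= alpha.
  rewrite -(con_coord_le beta false) -thetaE leUx leIl andbT.
  by apply: le_trans (omega_gamma _) _.
exists theta; split=> //; last first.
  apply/le_anti/andP; split; first by rewrite leI2 // con_coord_le.
  by rewrite lexI le_qt leIr.
have abd : alpha `|` beta = delta by case: pentagonH => _ [_ _ _ []].
apply: pentagonP => //.
- rewrite lt_neqAle le_gt andbT; apply: contra nle_qc0 => /eqP gt.
  by move: le_qt; rewrite -gt.
- by apply/le_anti/andP; split; [rewrite -abw | rewrite -gbw]; rewrite leI2.
- by apply/le_anti/andP; split; [rewrite -abd | rewrite -gbd]; rewrite leU2.
Qed.

End Pentagon.

(** * Choosing the pentagon *)

Lemma pentagon_choice (S : signature) (A : algebra S)
    (omega gamma alpha beta delta : Con A) :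
    pentagon omega gamma alpha beta delta ->
  exists alpha' : Con A,
    [/\ pentagon omega gamma alpha' beta delta,
        sublattice_iso (pentagon_sublattice gamma alpha' beta) K <->
          con_coord beta false alpha' `&` con_coord beta true gamma ><
          con_coord beta false gamma `&` con_coord beta true alpha'
      & sublattice_iso (pentagon_sublattice gamma alpha' beta) M1 <->
          con_coord beta false alpha' `&` con_coord beta true gamma >=<
          con_coord beta false gamma `&` con_coord beta true alpha'].
Proof.
move=> P; have [le_qc0|nle_qc0] :=
  boolP (con_coord beta false alpha `&` con_coord beta true gamma
         <= con_coord beta false gamma).
  have isoM := pentagon_M1 P le_qc0.
  exists alpha; split=> //; rewrite (pentagon_comparable P) le_qc0 //.
  by split=> // /(K_M1_not_iso isoM).
have [alpha' [P' qE a0E]] := pentagon_shrink P nle_qc0.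
have isoK : sublattice_iso (pentagon_sublattice gamma alpha' beta) K.
  by apply: (pentagon_K P'); rewrite qE // a0E.
exists alpha'; split=> //; rewrite (pentagon_comparable P') qE (negPf nle_qc0) //.
by split=> // /K_M1_not_iso/(_ isoK).
Qed.

Theorem theorem1p1 (S : signature) (A : algebra S) :
  ~ modular_lattice (Con A) ->
  exists omega gamma alpha beta delta : Con A,
    [/\ pentagon omega gamma alpha beta delta,
        (exists gamma' alpha' beta' delta' : Con A,
           standard_pentagon gamma' alpha' beta' delta') -> omega = \bot,
        sublattice_iso (pentagon_sublattice gamma alpha beta) K <->
          con_coord beta false alpha `&` con_coord beta true gamma ><
          con_coord beta false gamma `&` con_coord beta true alpha
      & sublattice_iso (pentagon_sublattice gamma alpha beta) M1 <->
          con_coord beta false alpha `&` con_coord beta true gamma >=<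
          con_coord beta false gamma `&` con_coord beta true alpha].
Proof.
move=> nonmod.
have [omega [gamma [alpha [beta [delta [P std]]]]]] :
    exists omega gamma alpha beta delta : Con A,
      pentagon omega gamma alpha beta delta /\
      ((exists gamma' alpha' beta' delta' : Con A,
          standard_pentagon gamma' alpha' beta' delta') -> omega = \bot).
  (* Failure of modularity alone may give a bottom above [\bot], so a standard pentagon is preferred
     if one exists; [pentagon_choice] changes only [alpha]. *)
  have [[g [a [b [d P]]]] | no_std] := pselect (exists g a b d : Con A,
    standard_pentagon g a b d); first by exists \bot, g, a, b, d.
  have [w [g [a [b [d P]]]]] := nonmodular_pentagon nonmod.
  by exists w, g, a, b, d; split=> // /no_std.
have [alpha' [P' isoK isoM]] := pentagon_choice P.
by exists omega, gamma, alpha', beta, delta; split.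
Qed.
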